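(* Let $n\ge 1$ be an integer, and let $T(n)$ be the maximum number of unit distances determined by an $n$-point subset of the Euclidean plane $\mathbb{R}^2$ with rationally independent unit direction set. Then $T(n)$ is also equal to: (a) the maximum number of edges determined by $n$ points in the standard countably infinite integer lattice graph $\mathbb{Z}^\infty$; (b) the maximum number of edges determined by $n$ points in the standard countably infinite hypercube graph $\{0,1\}^\infty$. Furthermore, $T(n+1)-T(n)=H(n)$, where $H(n)$ is the Hamming weight of $n$, i.e. the number of nonzero binary coefficients in the binary expansion of $n$. If $n=\sum_{j=1}^t 2^{k_j}$ where $k_1>k_2>\dots>k_t\ge 0$ are integers, then $$T(n)=\sum_{j=1}^t\left(k_j2^{k_j-1}+(j-1)2^{k_j}\right),$$ and in particular one always has (that is, for every $n\ge 1$) $$\frac{n}{4}\left(\lceil \log n\rceil-1\right)<T(n)<n\lceil\log n\rceil,$$ where $\log$ is the base 2 logarithm and $\lceil x\rceil$ is the smallest integer greater than or equal to $x$. Thus $T(n)$ is $\Theta(n\log n)$.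
   Context: For a finite set $A\subset\mathbb{R}^2$, the number of unit distances determined by $A$ is the number of unordered pairs $\{x,y\}\subset A$ with $\|x-y\|=1$ (Euclidean norm). The unit direction set of $A$ is $$D_A=\{x-y \mid x,y\in A,\ \|x-y\|=1,\ \mathrm{Arg}(x-y)\in[0,\pi)\},$$ a subset of the unit circle $S^1$, where $\mathrm{Arg}$ is the principal argument in radians. $A$ has rationally independent unit direction set if the (distinct) elements of $D_A$ are linearly independent over $\mathbb{Q}$ (the empty set counts as independent). The graph $\mathbb{Z}^\infty$ has as vertices the eventually zero integer sequences, with two vertices adjacent if and only if they differ in exactly one coordinate, by $\pm1$ (equivalently, their $\ell^1$-distance is $1$). The graph $\{0,1\}^\infty$ is its induced subgraph on the eventually zero sequences with all entries in $\{0,1\}$. The number of edges determined by a finite set of vertices is the number of edges of the ambient graph with both endpoints in the set.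
   Formalization: The strict upper bound T(n) < n⌈log n⌉ is stated only for n ≥ 2, because at n = 1 both sides equal 0 and the claimed inequality is false; everything else is stated for all n ≥ 1. *)

(* Defs.v *)
From HB Require Import structures.
From mathcomp Require Import all_boot all_order all_algebra.
From mathcomp Require Import finmap.
From mathcomp Require Import all_classical all_reals all_analysis.

Set Implicit Arguments.
Unset Strict Implicit.
Unset Printing Implicit Defensive.

Import Order.TTheory GRing.Theory Num.Theory.

Local Open Scope fset_scope.
Local Open Scope classical_set_scope.
Local Open Scope ring_scope.

Definition is_max (S : set nat) (m : nat) : Prop := S m /\ ubound S m.

(* For a symmetric adj, the two orientations (x, y), (y, x) of an edge have the
   same image [fset x; y], so each edge is counted once. *)
Definition num_edges (V : choiceType) (adj : V -> V -> Prop) (A : {fset V})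
    : nat :=
  #|` [fset [fset x; y] | x in A, y in A & `[< adj x y >] ] |.

Section Plane.
Variable R : realType.
Implicit Types v x y : 'rV[R]_2.

(* The norm `|v| that the library puts on 'rV[R]_2 is the sup norm. *)
Definition enorm v : R := Num.sqrt (\sum_(i < 2) v ord0 i ^+ 2).

Definition unit_dist x y : Prop := enorm (x - y) = 1.

(* theta is the principal argument of the nonzero vector v *)
Definition is_Arg v (theta : R) : Prop :=
  [/\ - pi < theta <= pi,
      v ord0 ord0 = enorm v * cos theta &
      v ord0 ord_max = enorm v * sin theta].

Definition unit_directions (A : {fset 'rV[R]_2}) : set 'rV[R]_2 :=
  [set v | exists x y, [/\ x \in A, y \in A, v = x - y, enorm v = 1 &
     exists2 theta, is_Arg v theta & 0 <= theta < pi] ].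

Definition rationally_independent (D : set 'rV[R]_2) : Prop :=
  forall (F : {fset 'rV[R]_2}) (c : 'rV[R]_2 -> rat),
    (forall v, v \in F -> D v) ->
    \sum_(v <- F) ratr (c v) *: v = 0 ->
    forall v, v \in F -> c v = 0.

Definition planar_counts (n : nat) : set nat :=
  [set m | exists A : {fset 'rV[R]_2},
     [/\ #|` A | = n, rationally_independent (unit_directions A) &
         num_edges unit_dist A = m] ].

Definition log2 (x : R) : R := ln x / ln 2.

End Plane.

Definition Zinf : choiceType := {fsfun nat -> int with 0}.

Definition lattice_adj (x y : Zinf) : Prop :=
  exists2 i : nat, `|x i - y i| = 1 & forall j, j != i -> x j = y j.

Definition cube_vertex (x : Zinf) : Prop := forall i : nat, x i = 0 \/ x i = 1.

Definition lattice_counts (n : nat) : set nat :=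
  [set m | exists A : {fset Zinf},
     #|` A | = n /\ num_edges lattice_adj A = m].

Definition cube_counts (n : nat) : set nat :=
  [set m | exists A : {fset Zinf},
     [/\ #|` A | = n, (forall x, x \in A -> cube_vertex x) &
         num_edges lattice_adj A = m] ].

(* The range i < n covers all nonzero binary digits since n < 2 ^ n. *)
Definition hamming_weight (n : nat) : nat :=
  #|[set i : 'I_n | odd (n %/ 2 ^ i)]|.

(* Main.v *)
Require Import Defs.
From mathcomp Require Import all_boot all_order all_algebra.
From mathcomp Require Import finmap.
From mathcomp Require Import all_classical all_reals all_analysis.
From mathcomp Require Import zify ring lra.

Set Implicit Arguments.
Unset Strict Implicit.
Unset Printing Implicit Defensive.

Import Order.TTheory GRing.Theory Num.Theory numFieldNormedType.Exports.

Local Open Scope classical_set_scope.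
Local Open Scope ring_scope.

(** The function [T n] is the sum of the binary digit sums of [0, ..., n - 1]
    ([digit_total]), so that [T (n + 1) - T n] is the Hamming weight of [n] by
    definition.

    Upper bounds. Halving the argument gives recursions for [T], and from them
    the superadditivity [T a + T b + min (a, b) <= T (a + b)]
    ([digit_total_superadd]). Hence, by induction on the number of vertices, a
    finite graph has at most [T n] edges on any [n] of its vertices as soon as
    each edge is separated by a cut whose crossing edges form a matching
    ([num_edges_le_digit_total]): such a cut into parts of sizes [a] and [b]
    is crossed by at most [min (a, b)] edges. In the lattice, a half space
    bounding one coordinate is such a cut. In the plane, with [D] the
    rationally independent set of directions and [d] in [D], the edge from [y]
    to [y + d] is separated by the set of the points [y - k d + s], where [k] is
    a natural number and [s] is in the rational span of [D] without [d]: the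
    only edges leaving this set are translations by [d] ([planar_cut]).

    Lower bounds. Join [n] to [n - 2 ^ i] for every nonzero binary digit [i] of
    [n]. The vertices [0, ..., n - 1] then span [T n] edges, and listing binary
    digits realizes this graph in the hypercube. Replacing the unit coordinate
    vectors by unit vectors of the plane realizes it by unit distances, but the
    images might have further unit differences, which could spoil independence.
    The unit vectors are therefore chosen generic: a rational combination of
    them has length 1 only if it has a single nonzero coefficient, a condition
    which also implies rational independence ([generic_independent]). They are
    found one at a time, as each new vector only has to avoid a countable
    subset of the circle ([generic_exists]).

    The explicit formula, and the logarithmic bounds, follow from
    [T (2 ^ k + m) = T (2 ^ k) + T m + m] for [m <= 2 ^ k]
    ([digit_total_add_exp2]). *)

(** * Digit sums *)

Section DigitSums.
Local Open Scope nat_scope.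

(** The sum of the binary digit sums of [0, ..., n - 1]; this is the common
    extremal function of the three edge counting problems. *)
Definition digit_total (n : nat) : nat := \sum_(i < n) hamming_weight i.

Lemma hamming_weightE (m n : nat) : n < 2 ^ m ->
  hamming_weight n = \sum_(i < m) odd (n %/ 2 ^ i).
Proof.
move=> lt_n; rewrite /hamming_weight.
rewrite -sum1_card big_mkcond /=.
under eq_bigr => i _ do rewrite -topredE /= /in_set /= asboolb.
have -> : \sum_(i < n) (if odd (n %/ 2 ^ i) then 1 else 0)
        = \sum_(i < n) odd (n %/ 2 ^ i) by apply: eq_bigr => i _; case: odd.
(* Digits of index at least [p] vanish as soon as [n < 2 ^ p]. *)
have widen (p q : nat) : n < 2 ^ p -> p <= q ->
    \sum_(i < p) odd (n %/ 2 ^ i) = \sum_(i < q) odd (n %/ 2 ^ i).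
  move=> ltp lepq; rewrite -!(big_mkord xpredT (fun i => odd (n %/ 2 ^ i) : nat)).
  rewrite [RHS](big_cat_nat (leq0n p) lepq) /= [X in _ + X]big_nat_cond.
  rewrite [X in _ + X]big1 ?addn0 // => i /andP[/andP[lepi _] _].
  by rewrite divn_small // (leq_trans ltp) // leq_exp2l.
have ltn : n < 2 ^ n by rewrite ltn_expl.
by case: (leqP n m) => [/widen->|/ltnW/widen->].
Qed.

Lemma hamming_weight_half (n : nat) :
  hamming_weight n = odd n + hamming_weight n./2.
Proof.
have lt_n : n < 2 ^ n by rewrite ltn_expl.
have lt_n1 : n < 2 ^ n.+1 by rewrite (leq_trans lt_n) // leq_exp2l.
have lt_h : n./2 < 2 ^ n by rewrite (leq_ltn_trans _ lt_n) // -divn2 leq_div.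
rewrite (hamming_weightE lt_n1) (hamming_weightE lt_h) big_ord_recl /= expn0.
rewrite divn1; congr (_ + _); apply: eq_bigr => i _.
by rewrite /= -divn2 -divnMA -expnS.
Qed.

Lemma digit_totalS (n : nat) :
  digit_total n.+1 = digit_total n + hamming_weight n.
Proof. by rewrite /digit_total big_ord_recr. Qed.

Lemma digit_total0 : digit_total 0 = 0.
Proof. by rewrite /digit_total big_ord0. Qed.

Lemma digit_total1 : digit_total 1 = 0.
Proof. by rewrite digit_totalS digit_total0 (@hamming_weightE 0) ?big_ord0. Qed.

Lemma digit_total_double (n : nat) :
  digit_total n.*2 = (digit_total n).*2 + n.
Proof.
elim: n => [|n IHn]; first by rewrite digit_total0.
rewrite doubleS !digit_totalS IHn (hamming_weight_half n.*2.+1).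
by rewrite (hamming_weight_half n.*2) /= odd_double uphalf_double doubleK; lia.
Qed.

Lemma digit_total_doubleS (n : nat) :
  digit_total n.*2.+1 = digit_total n + digit_total n.+1 + n.
Proof.
rewrite !digit_totalS digit_total_double (hamming_weight_half n.*2).
by rewrite odd_double doubleK; lia.
Qed.

(** Induction on [a + b], halving both arguments. *)
Lemma digit_total_superadd (a b : nat) :
  digit_total a + digit_total b + minn a b <= digit_total (a + b).
Proof.
have [N] := ubnP (a + b); elim: N a b => // N IHN a b ltN.
have [le1|gt1] := leqP (a + b) 1.
  have [[-> ->]|[[-> ->]|[-> ->]]] :
      a = 0 /\ b = 0 \/ a = 0 /\ b = 1 \/ a = 1 /\ b = 0 by lia.
  - by rewrite digit_total0.
  - by rewrite digit_total0 digit_total1.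
  - by rewrite digit_total0 digit_total1.
rewrite -(odd_double_half a) -(odd_double_half b).
set p := a./2; set q := b./2.
have defa := odd_double_half a; have defb := odd_double_half b.
rewrite -/p in defa; rewrite -/q in defb.
case: (odd a) defa => defa; case: (odd b) defb => defb; rewrite ?add1n ?add0n.
- have -> : p.*2.+1 + q.*2.+1 = (p + q.+1).*2 by lia.
  rewrite !digit_total_doubleS digit_total_double.
  have := IHN p q.+1; have := IHN p.+1 q; rewrite addSnnS; lia.
- have -> : p.*2.+1 + q.*2 = (p + q).*2.+1 by lia.
  rewrite !digit_total_doubleS digit_total_double.
  have := IHN p q; have := IHN p.+1 q; rewrite addSn; lia.
- have -> : p.*2 + q.*2.+1 = (p + q).*2.+1 by lia.
  rewrite !digit_total_doubleS digit_total_double.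
  have := IHN p q; have := IHN p q.+1; rewrite addnS; lia.
- have -> : p.*2 + q.*2 = (p + q).*2 by lia.
  rewrite !digit_total_double.
  have := IHN p q; lia.
Qed.

Lemma digit_total_exp2 (k : nat) : digit_total (2 ^ k) = k * 2 ^ k.-1.
Proof.
elim: k => [|k IHk]; first by rewrite digit_total1.
rewrite expnS mul2n digit_total_double IHk /=.
by case: k {IHk} => [|k] //=; rewrite expnS; lia.
Qed.

Lemma digit_total_add_exp2 (k m : nat) : m <= 2 ^ k ->
  digit_total (2 ^ k + m) = digit_total (2 ^ k) + digit_total m + m.
Proof.
elim: k m => [|k IHk] m.
  rewrite expn0; case: m => [|[|//]] _ /=; first by rewrite digit_total0 !addn0.
  by rewrite (digit_total_double 1) digit_total1.
rewrite expnS mul2n; move: (odd_double_half m).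
case: (odd m); rewrite ?add1n ?add0n => <- lem.
  rewrite addnS -doubleD digit_total_double !digit_total_doubleS -addnS.
  rewrite !IHk; lia.
rewrite -doubleD !digit_total_double IHk; lia.
Qed.

Lemma digit_total_binary (t : nat) (k : 'I_t -> nat) :
  (forall i j : 'I_t, i < j -> k j < k i) ->
  digit_total (\sum_(j < t) 2 ^ k j)
    = \sum_(j < t) (k j * 2 ^ (k j).-1 + j * 2 ^ k j).
Proof.
have sum_lt (s N : nat) (l : 'I_s -> nat) : (forall j, l j < N) ->
    (forall i j : 'I_s, i < j -> l j < l i) -> \sum_(j < s) 2 ^ l j < 2 ^ N.
  elim: s N l => [|s IHs] N l ltN decr; first by rewrite big_ord0 expn_gt0.
  rewrite big_ord_recl; apply: (@leq_trans (2 ^ (l ord0).+1)).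
    rewrite expnS mul2n -addnn -addnS leq_add2l.
    by apply: IHs => [j|i j ltij]; apply: decr.
  by rewrite leq_exp2l.
elim: t k => [|t IHt] k decr; first by rewrite !big_ord0 digit_total0.
rewrite !big_ord_recl digit_total_add_exp2.
  rewrite IHt; last by move=> i j ltij; apply: decr.
  rewrite digit_total_exp2 mul0n addn0 -addnA; congr (_ + _).
  rewrite -big_split /=; apply: eq_bigr => i _.
  by rewrite /bump /= mulSn; lia.
by apply/ltnW/sum_lt => [j|i j ltij]; apply: decr.
Qed.

Lemma digit_total_le (L n : nat) : n <= 2 ^ L -> 2 * digit_total n <= n * L.
Proof.
elim: L n => [|L IHL] n.
  by case: n => [|[|//]] _; rewrite ?digit_total0 ?digit_total1.
case: (leqP n (2 ^ L)) => [leL _|gtL leS].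
  by rewrite (leq_trans (IHL _ leL)) // leq_mul2l leqnSn orbT.
have lem : n - 2 ^ L <= 2 ^ L by rewrite expnS in leS; lia.
rewrite -(subnKC (ltnW gtL)) digit_total_add_exp2 //.
by have := IHL _ lem; have := IHL _ (leqnn _); nia.
Qed.

Lemma digit_total_gt (L n : nat) : 2 ^ L < n -> n <= 2 ^ L.+1 ->
  n * L < 4 * digit_total n.
Proof.
move=> gtL leS; have lem : n - 2 ^ L <= 2 ^ L by rewrite expnS in leS; lia.
rewrite -(subnKC (ltnW gtL)) digit_total_add_exp2 // digit_total_exp2.
have : L * 2 ^ L = 2 * (L * 2 ^ L.-1) by case: (L) => // l; rewrite expnS /=; lia.
by nia.
Qed.

End DigitSums.

(** * Counting edges *)

Section EdgeCounting.
Local Open Scope fset_scope.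
Variables (V : choiceType) (adj : V -> V -> Prop).

(** The edges with both ends in [A], as unordered pairs. *)
Definition edge_set (A : {fset V}) : {fset {fset V}} :=
  [fset [fset x; y] | x in A, y in A & `[< adj x y >] ].

Lemma num_edgesE (A : {fset V}) : num_edges adj A = #|` edge_set A|.
Proof. by []. Qed.

Lemma edge_setP (A : {fset V}) (e : {fset V}) :
  reflect (exists x y, [/\ x \in A, y \in A, adj x y & e = [fset x; y]])
          (e \in edge_set A).
Proof.
apply: (iffP (imfset2P _ _ _ _ _)).
  by move=> [x xA [y /andP[yA /asboolP xy] ->]]; exists x, y.
move=> [x [y [xA yA xy ->]]]; exists x => //; exists y => //.
by apply/andP; split => //; apply/asboolP.
Qed.

Hypothesis adjC : forall x y, adj x y -> adj y x.

(** If every edge inside [S] is separated by a bipartition [P] of [S] in which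
    no vertex has two neighbours on the other side, then [n] vertices of [S]
    determine at most [digit_total n] edges. *)
Lemma num_edges_le_digit_total (S : {fset V}) :
  (forall x y, x \in S -> y \in S -> adj x y ->
    exists P : pred V, P x != P y /\
      forall u w w', u \in S -> w \in S -> w' \in S ->
        adj u w -> adj u w' -> P u != P w -> P u != P w' -> w = w') ->
  forall A, A `<=` S -> (num_edges adj A <= digit_total #|` A|)%N.
Proof.
move=> cutS A; have [N] := ubnP #|` A|; elim: N A => // N IHN A ltN subAS.
rewrite num_edgesE.
have [->|[e /edge_setP[x [y [xA yA xy _]]]]] := fset_0Vmem (edge_set A).
  by rewrite cardfs0.
have inS z : z \in A -> z \in S by apply: (fsubsetP subAS).
have [P [Pxy cutP]] := cutS x y (inS _ xA) (inS _ yA) xy.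
pose side (b : bool) := [fset z in A | P z == b].
have inside b z : (z \in side b) = (z \in A) && (P z == b) by rewrite !inE.
have side_sub b : side b `<=` A.
  by apply/fsubsetP => z; rewrite inside => /andP[].
have card_side : (#|` side true| + #|` side false| = #|` A|)%N.
  rewrite -[RHS](cardfsID (side true)); congr (_ + _)%N; congr #|` _|.
    by apply/esym/fsetIidPr.
  apply/fsetP => z; rewrite in_fsetD !inside.
  by case: (z \in A) => //=; case: (P z).
have side_lt b : (#|` side b| < #|` A|)%N.
  apply: fproper_ltn_card; rewrite fproperEneq side_sub andbT.
  apply: contraNneq Pxy => sideA; move: xA yA.
  by rewrite -sideA !inside => /andP[_ /eqP->] /andP[_ /eqP->].
(* An edge across the cut is determined by its endpoint on a given side. *)
pose across (u : V) := xget u [set w | [/\ w \in A, adj u w & P u != P w]].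
pose cross := edge_set A `\` (edge_set (side true) `|` edge_set (side false)).
have cross_le b : (#|` cross| <= #|` side b|)%N.
  suff sub : cross `<=` [fset [fset u; across u] | u in side b].
    by apply: leq_trans (fsubset_leq_card sub) _; apply: leq_imfset_card.
  apply/fsubsetP => f; rewrite in_fsetD in_fsetU negb_or -andbA.
  move=> /and3P[fT fF /edge_setP[u [w [uA wA uw deff]]]].
  have Puw : P u != P w.
    apply/negP => /eqP Pe; case Pu : (P u) Pe => /esym Pw.
      case/negP: fT; apply/edge_setP; exists u, w.
      by rewrite !inside uA wA Pu Pw.
    case/negP: fF; apply/edge_setP; exists u, w.
    by rewrite !inside uA wA Pu Pw.
  have acrossE v z : v \in A -> z \in A -> adj v z -> P v != P z ->
      across v = z.
    move=> vA zA vz Pvz; rewrite /across.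
    case: xgetP => [w' _ [w'A vw' Pw']|/(_ z) []//].
    by apply: (cutP v); rewrite ?inS.
  have [Pu|Pu] := eqVneq (P u) b; apply/imfsetP.
    by exists u; rewrite ?inside ?uA ?Pu //= (acrossE u w).
  exists w; last first.
    by rewrite (acrossE w u) //= 1?eq_sym // 1?deff 1?fsetUC //; apply: adjC.
  rewrite /= inside wA /=.
  by move: Puw Pu; case: (P u); case: (P w); case: (b).
have edge_le : (#|` edge_set A| <=
    #|` edge_set (side true)| + #|` edge_set (side false)| + #|` cross|)%N.
  rewrite -(cardfsID (edge_set (side true) `|` edge_set (side false))).
  rewrite leq_add // (leq_trans (fsubset_leq_card (fsubsetIr _ _))) //.
  exact: leq_card_fsetU.
apply: leq_trans edge_le _; rewrite -card_side.
apply: leq_trans (digit_total_superadd _ _).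
rewrite leq_add //; last by rewrite leq_min !cross_le.
rewrite leq_add // -num_edgesE; apply: IHN.
- exact: leq_trans (side_lt _) ltN.
- exact: fsubset_trans subAS.
- exact: leq_trans (side_lt _) ltN.
- exact: fsubset_trans subAS.
Qed.

Lemma hamming_weight_count (n : nat) :
  hamming_weight n = size [seq i <- iota 0 n | odd (n %/ 2 ^ i)].
Proof.
rewrite (hamming_weightE (ltn_expl n (ltnSn 1))) size_filter -sum1_count.
rewrite [RHS]big_mkcond /= -(big_mkord xpredT (fun i => odd (n %/ 2 ^ i) : nat)).
by rewrite /index_iota subn0; apply: eq_bigr => i _; case: odd.
Qed.

(** The vertices are added one at a time: [b n] is joined to [b (n - 2 ^ i)]
    for every nonzero binary digit [i] of [n]. *)
Lemma digit_total_le_num_edges (N : nat) (b : nat -> V) :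
  (forall p q, (p < N)%N -> (q < N)%N -> b p = b q -> p = q) ->
  (forall p i, (p < N)%N -> odd (p %/ 2 ^ i) -> adj (b p) (b (p - 2 ^ i)%N)) ->
  (digit_total N <= num_edges adj [fset b i | i in iota 0 N])%N.
Proof.
move=> b_inj b_adj; pose vert n := [fset b i | i in iota 0 n].
have vertP n x : reflect (exists2 i, (i < n)%N & x = b i) (x \in vert n).
  apply: (iffP (imfsetP _ _ _ _)) => -[i] /=.
    by rewrite mem_iota add0n => lti ->; exists i.
  by move=> lti ->; exists i; rewrite //= mem_iota.
suff le_n n : (n <= N)%N -> (digit_total n <= num_edges adj (vert n))%N.
  exact: le_n.
elim: n => [|n IHn] ltnN; first by rewrite digit_total0.
pose digits := [fset i in [seq i <- iota 0 n | odd (n %/ 2 ^ i)]].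
have digitsP i : i \in digits -> odd (n %/ 2 ^ i).
  by rewrite !inE /= mem_filter => /andP[].
have le_pow i : odd (n %/ 2 ^ i) -> (2 ^ i <= n)%N.
  by case: leqP => // /divn_small->.
pose edge i := [fset b n; b (n - 2 ^ i)%N].
have lt_sub i : odd (n %/ 2 ^ i) -> (n - 2 ^ i < n)%N.
  move=> odd_i; have := le_pow i odd_i; have := expn_gt0 2 i.
  by move=> /=; lia.
have card_new : #|` [fset edge i | i in digits]| = hamming_weight n.
  rewrite card_in_imfset => [|i j /digitsP di /digitsP dj] /=.
    rewrite hamming_weight_count card_fseq undup_id //.
    by rewrite filter_uniq // iota_uniq.
  have [lti ltj] := (lt_sub i di, lt_sub j dj).
  move=> /fsetP /(_ (b (n - 2 ^ i)%N)); rewrite !inE eqxx orbT => /esym/orP[]/eqP.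
    by move/b_inj => beq; have := beq ltac:(lia) ltac:(lia); lia.
  move/b_inj => beq; have := beq ltac:(lia) ltac:(lia).
  have := le_pow i di; have := le_pow j dj => lei lej eqij.
  have /eqP : (2 ^ i = 2 ^ j)%N by lia.
  by rewrite eqn_exp2l // => /eqP.
have old_new : edge_set (vert n) `|` [fset edge i | i in digits]
    `<=` edge_set (vert n.+1).
  apply/fsubsetP => e /fsetUP[/edge_setP[x [y [xn yn xy ->]]]|].
    apply/edge_setP; exists x, y; split=> //.
      by have [i lti ->] := vertP _ _ xn; apply/vertP; exists i => //; apply: ltnW.
    by have [i lti ->] := vertP _ _ yn; apply/vertP; exists i => //; apply: ltnW.
  move=> /imfsetP[i /digitsP di ->]; apply/edge_setP.
  exists (b n), (b (n - 2 ^ i)%N); split=> //; last exact: b_adj.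
    by apply/vertP; exists n.
  by apply/vertP; exists (n - 2 ^ i)%N => //; have := lt_sub i di; lia.
have disj : edge_set (vert n) `&` [fset edge i | i in digits] = fset0.
  apply/fsetP => e; rewrite !inE; apply/negP => /andP[].
  move=> /edge_setP[x [y [/vertP[p ltp ->] /vertP[q ltq ->] _ ->]]].
  move=> /imfsetP[i _ /fsetP/(_ (b n))]; rewrite !inE eqxx /= => /orP[]/eqP.
    by move/b_inj => beq; have := beq ltac:(lia) ltac:(lia); lia.
  by move/b_inj => beq; have := beq ltac:(lia) ltac:(lia); lia.
rewrite digit_totalS -card_new num_edgesE.
apply: leq_trans (fsubset_leq_card old_new).
by rewrite cardfsU disj cardfs0 subn0 leq_add2r IHn // ltnW.
Qed.

End EdgeCounting.

(** * Lattice and hypercube *)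

Lemma divn_exp2S (p i : nat) : (p %/ 2 ^ i.+1 = p./2 %/ 2 ^ i)%N.
Proof. by rewrite expnS divnMA divn2. Qed.

Lemma eq_binary_digits (p q : nat) :
  (forall i, odd (p %/ 2 ^ i) = odd (q %/ 2 ^ i)) -> p = q.
Proof.
have [N] := ubnP (p + q); elim: N p q => // N IHN p q ltN eqpq.
have := eqpq 0%N; rewrite expn0 !divn1 => eq_odd.
case: (posnP (p + q)) => [|pq_gt0]; first by lia.
rewrite -(odd_double_half p) -(odd_double_half q) eq_odd; congr (_ + _.*2)%N.
by apply: IHN => [|i]; [lia | rewrite -!divn_exp2S].
Qed.

(** Removing the nonzero digit [i] of [p] leaves the other digits unchanged. *)
Lemma binary_digit_sub (p i j : nat) : odd (p %/ 2 ^ i) ->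
  odd ((p - 2 ^ i) %/ 2 ^ j) = (j != i) && odd (p %/ 2 ^ j).
Proof.
elim: i p j => [|i IHi] p j.
  rewrite expn0 divn1 => odd_p; case: j => [|j]; first by rewrite expn0 divn1; lia.
  by rewrite !divn_exp2S /=; congr (odd (_ %/ _)); lia.
rewrite divn_exp2S => odd_p.
have le_p : (2 ^ i <= p./2)%N by case: leqP odd_p => // /divn_small->.
have half_sub : ((p - 2 ^ i.+1)./2 = p./2 - 2 ^ i)%N by rewrite expnS; lia.
case: j => [|j]; first by rewrite expn0 !divn1 /= expnS; lia.
by rewrite !divn_exp2S half_sub eqSS; apply: IHi.
Qed.

Lemma lattice_adjC (x y : Zinf) : lattice_adj x y -> lattice_adj y x.
Proof.
move=> [i xyi xy]; exists i => [|j ji]; first by rewrite distrC.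
by rewrite xy.
Qed.

(** If [x] and [y] differ in coordinate [i], the half space of the points whose
    coordinate [i] is at most the smaller of [x i] and [y i] cuts the lattice
    along a matching. *)
Lemma lattice_num_edges_le (A : {fset Zinf}) :
  (num_edges lattice_adj A <= digit_total #|` A|)%N.
Proof.
apply: (num_edges_le_digit_total lattice_adjC (S := A)) => // x y _ _ [i xyi _].
exists (fun z : Zinf => (z i <= x i) && (z i <= y i)); split; first by lia.
move=> u w w' _ _ _ [j uwj uw] [k uwk' uw'] Pw Pw'.
have ij : i = j.
  by apply/eqP/negPn/negP => ij; move: Pw; rewrite (uw i ij) eqxx.
have ik : i = k.
  by apply/eqP/negPn/negP => ik; move: Pw'; rewrite (uw' i ik) eqxx.
subst j k; apply/fsfunP => l; have [->|li] := eqVneq l i; first by lia.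
by rewrite -uw // -uw'.
Qed.

(** The vertex of the hypercube listing the binary digits of [p]. *)
Definition binary_vertex (p : nat) : Zinf :=
  [fsfun i in [fset j in iota 0 p]%fset => Posz (odd (p %/ 2 ^ i)) | 0].

Lemma binary_vertexE (p i : nat) :
  binary_vertex p i = Posz (odd (p %/ 2 ^ i)).
Proof.
rewrite fsfun_fun !inE /= mem_iota add0n /=; case: ltnP => // le_pi.
by rewrite divn_small // (leq_trans (ltn_expl p (ltnSn 1))) // leq_exp2l.
Qed.

Lemma binary_vertex_inj : injective binary_vertex.
Proof.
move=> p q eqpq; apply: eq_binary_digits => i.
have := congr1 (fun z : Zinf => z i) eqpq; rewrite !binary_vertexE.
by case: odd; case: odd.
Qed.

Lemma binary_vertex_adj (p i : nat) : odd (p %/ 2 ^ i) ->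
  lattice_adj (binary_vertex p) (binary_vertex (p - 2 ^ i)).
Proof.
move=> odd_i; exists i => [|j ji]; rewrite !binary_vertexE binary_digit_sub //.
  by rewrite odd_i eqxx.
by rewrite ji.
Qed.

Lemma cube_count_max (n : nat) : is_max (cube_counts n) (digit_total n).
Proof.
split=> [|_ [A [<- _ <-]]]; last exact: lattice_num_edges_le.
pose A := [fset binary_vertex i | i in iota 0 n]%fset.
have cardA : #|` A| = n.
  rewrite card_imfset /=; last exact: binary_vertex_inj.
  by rewrite undup_id ?iota_uniq // size_iota.
exists A; split=> // [x /imfsetP[p _ ->] i|].
  by rewrite binary_vertexE; case: odd; [right | left].
have := lattice_num_edges_le A; rewrite cardA => le_edges.
apply/eqP; rewrite eqn_leq le_edges /=.
apply: digit_total_le_num_edges => [p q _ _|p i _]; first exact: binary_vertex_inj.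
exact: binary_vertex_adj.
Qed.

Lemma lattice_count_max (n : nat) : is_max (lattice_counts n) (digit_total n).
Proof.
have [[A [cardA _ edgesA]] _] := cube_count_max n.
split; first by exists A.
by move=> _ [B [<- <-]]; apply: lattice_num_edges_le.
Qed.

(** * Unit distances: the upper bound *)

Section PlaneUpper.
Variable R : realType.
Implicit Types (v w x y : 'rV[R]_2) (A F : {fset 'rV[R]_2}) (c : 'rV[R]_2 -> rat).

Lemma enorm_eq1 v :
  enorm v = 1 <-> v ord0 ord0 ^+ 2 + v ord0 ord_max ^+ 2 = 1.
Proof.
have s_ge0 : 0 <= v ord0 ord0 ^+ 2 + v ord0 ord_max ^+ 2.
  by rewrite addr_ge0 ?sqr_ge0.
have -> : enorm v = Num.sqrt (v ord0 ord0 ^+ 2 + v ord0 ord_max ^+ 2).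
  by rewrite /enorm big_ord_recr big_ord1 /=; congr (Num.sqrt (v _ _ ^+ 2 + _));
     apply: val_inj.
split=> [sqrt1|->]; last by rewrite sqrtr1.
by rewrite -(sqr_sqrtr s_ge0) sqrt1 expr1n.
Qed.

Lemma enormN v : enorm (- v) = enorm v.
Proof. by congr Num.sqrt; apply: eq_bigr => i _; rewrite mxE sqrrN. Qed.

Lemma unit_distC x y : unit_dist x y -> unit_dist y x.
Proof. by rewrite /unit_dist -opprB enormN. Qed.

(** The principal argument of [v] lies in [0, pi), the half-open interval that
    contains exactly one of two opposite directions. *)
Definition upper_direction v : Prop :=
  exists2 theta, is_Arg v theta & 0 <= theta < pi.

Lemma upper_direction_pos v :
  enorm v = 1 -> 0 < v ord0 ord_max -> upper_direction v.
Proof.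
move=> v1 b_gt0; have /enorm_eq1 := v1.
move: b_gt0; set a := v ord0 ord0; set b := v ord0 ord_max => b_gt0 ab1.
have a_gt : -1 < a by nra.
have a_lt : a < 1 by nra.
have a_in : -1 <= a <= 1 by rewrite !ltW.
have theta_pi : 0 <= acos a < pi by rewrite acos_ge0 //= acos_ltpi // a_gt ltW.
exists (acos a) => //; split; rewrite ?v1 ?mul1r.
- by have := @pi_gt0 R; case/andP: theta_pi; lra.
- by rewrite acosK // in_itv.
- rewrite sin_acos // -[LHS]ger0_norm; last exact: ltW.
  by rewrite -sqrtr_sqr; congr Num.sqrt; rewrite -/b; lra.
Qed.

Lemma upper_direction_or v :
  enorm v = 1 -> upper_direction v \/ upper_direction (- v).
Proof.
move=> v1; have [b_gt0|b_lt0|b0] := ltgtP 0 (v ord0 ord_max).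
- by left; apply: upper_direction_pos.
- by right; apply: upper_direction_pos; rewrite ?enormN // mxE oppr_gt0.
have arg0 w : enorm w = 1 -> w ord0 ord0 = 1 -> w ord0 ord_max = 0 ->
    upper_direction w.
  move=> w1 w01 w00; exists 0; last by rewrite lexx pi_gt0.
  by split; rewrite ?w1 ?mul1r ?cos0 ?sin0 //; have := @pi_gt0 R; lra.
have /enorm_eq1 := v1; rewrite -b0 expr0n addr0 => /eqP; rewrite sqrf_eq1.
case/orP => /eqP a1; [left|right]; apply: arg0; rewrite ?enormN ?mxE ?a1 -?b0 //.
  by rewrite opprK.
by rewrite oppr0.
Qed.

Lemma unit_directions_or A x y : x \in A -> y \in A -> unit_dist x y ->
  unit_directions A (x - y) \/ unit_directions A (y - x).
Proof.
move=> xA yA xy; case: (upper_direction_or xy) => [up|up]; [left|right].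
  by exists x, y.
by exists y, x; rewrite opprB in up; split=> //; apply: unit_distC.
Qed.

(** Linear combination of the members of [F] with rational coefficients. *)
Definition rat_comb F c : 'rV[R]_2 := \sum_(v <- F) ratr (c v) *: v.

Lemma rat_combD1 F c v (t : rat) : v \in F ->
  rat_comb F (fun w => c w + (if w == v then t else 0)) =
  rat_comb F c + ratr t *: v.
Proof.
move=> vF; rewrite /rat_comb.
under eq_bigr => w _ do rewrite rmorphD scalerDl.
rewrite big_split /=; congr (_ + _).
rewrite (bigD1_seq v) ?fset_uniq //= eqxx big1 ?addr0 // => w /negPf->.
by rewrite rmorph0 scale0r.
Qed.

(** The cut separating the ends [y] and [y + d] of an edge consists of the
    points reached from [y] by adding a natural multiple of [- d] and rational
    multiples of the other directions. By independence [y + d] is not reached,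
    and an edge leaving the cut can only be a translation by [d]. *)
Lemma planar_cut A (y d : 'rV[R]_2) :
  rationally_independent (unit_directions A) -> unit_directions A d ->
  exists P : pred 'rV[R]_2, [/\ P y, ~~ P (y + d) &
    forall u w, u \in A -> w \in A -> unit_dist u w -> P u -> ~~ P w ->
      w = u + d].
Proof.
move=> indep Dd.
pose F := [fset v in [fset p - q | p in A, q in A] | `[< unit_directions A v >]]%fset.
have FP v : reflect (unit_directions A v) (v \in F).
  apply: (iffP idP) => [|Dv]; first by rewrite !inE /= => /andP[_ /asboolP].
  rewrite !inE /=; apply/andP; split; last exact/asboolP.
  by have [p [q [pA qA -> _ _]]] := Dv; apply/imfset2P; exists p => //; exists q.
pose reached z := exists2 c, exists k : nat, c d = - k%:R &
  z = y + rat_comb F c.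
have step z v (t : rat) : reached z -> unit_directions A v ->
    (v = d -> t = -1) -> reached (z + ratr t *: v).
  move=> [c [k cd] ->] /FP vF td.
  exists (fun w => c w + (if w == v then t else 0)); last first.
    by rewrite rat_combD1 // addrA.
  case: eqVneq => [/esym/td->|_]; last by exists k; rewrite addr0.
  by exists k.+1; rewrite cd -natr1 opprD.
exists (fun z => `[< reached z >]); split.
- apply/asboolP; exists (fun=> 0); first by exists 0%N; rewrite oppr0.
  by rewrite /rat_comb big1 ?addr0 // => v _; rewrite rmorph0 scale0r.
- apply/asboolP => -[c [k cd] /addrI dE].
  have := indep F (fun w => c w + (if w == d then -1 else 0)).
  move=> /(_ (fun v vF => elimT (FP v) vF)) zero.
  have /FP dF := Dd; have /zero /(_ d dF) :
      rat_comb F (fun w => c w + (if w == d then -1 else 0)) = 0.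
    by rewrite rat_combD1 // -dE rmorphN rmorph1 scaleN1r subrr.
  rewrite /= eqxx cd => /eqP; rewrite -opprD oppr_eq0 natr1 pnatr_eq0.
  by [].
move=> u w uA wA uw /asboolP reached_u /asboolP not_w.
have [D_uw|D_wu] := unit_directions_or uA wA uw.
  case: not_w; have := step u (u - w) (-1) reached_u D_uw (fun=> erefl).
  by rewrite rmorphN rmorph1 scaleN1r opprB addrC subrK.
have [<-|ne_d] := eqVneq (w - u) d; first by rewrite addrC subrK.
case: not_w; have := step u (w - u) 1 reached_u D_wu.
rewrite rmorph1 scale1r (addrC u) subrK; apply=> eq_d.
by rewrite eq_d eqxx in ne_d.
Qed.

Lemma planar_num_edges_le A : rationally_independent (unit_directions A) ->
  (num_edges (@unit_dist R) A <= digit_total #|` A|)%N.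
Proof.
move=> indep.
apply: (num_edges_le_digit_total unit_distC (S := A)) => // x y xA yA xy.
wlog Dxy : x y xA yA xy / unit_directions A (x - y).
  move=> wlog_D; case: (unit_directions_or xA yA xy) => [|Dyx].
    exact: wlog_D.
  have [P [Pyx cutP]] := wlog_D y x yA xA (unit_distC xy) Dyx.
  by exists P; rewrite eq_sym.
have [P [Py Px cutP]] := planar_cut y indep Dxy.
rewrite addrC subrK in Px.
exists P; split=> [|u w w' uA wA w'A uw uw']; first by rewrite Py (negPf Px).
case Pu : (P u); case Pw : (P w); case Pw' : (P w') => // _ _.
  by rewrite (cutP u w) ?Pw // (cutP u w') ?Pw'.
apply: (addIr (x - y)); rewrite -(cutP w u) ?Pu //; last exact: unit_distC.
by rewrite -(cutP w' u) ?Pu //; apply: unit_distC.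
Qed.

End PlaneUpper.

(** * Generic unit vectors *)

Section GenericDirections.
Variable R : realType.
Implicit Types (a : nat -> R) (c : nat -> rat) (m : nat).

(** The point of the open upper half circle with abscissa [x]. *)
Definition upper_unit (x : R) : 'rV[R]_2 :=
  \row_(j < 2) (if j == ord0 then x else Num.sqrt (1 - x ^+ 2)).

Definition unit_comb m a c : 'rV[R]_2 :=
  \sum_(i < m) ratr (c i) *: upper_unit (a i).

(** The unit vectors of abscissas [a 0, ..., a m.-1] are generic when the only
    rational combinations of length 1 are the obvious ones, with a single
    nonzero coefficient. *)
Definition generic m a : Prop :=
  (forall i, (i < m)%N -> 0 < a i < 1) /\
  (forall c, enorm (unit_comb m a c) = 1 ->
    forall i j, (i < m)%N -> (j < m)%N -> c i != 0 -> c j != 0 -> i = j).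

Lemma enorm_upper_unit (x : R) : 0 < x < 1 -> enorm (upper_unit x) = 1.
Proof.
move=> /andP[x0 x1]; apply/enorm_eq1; rewrite !mxE /= sqr_sqrtr; first by lra.
by nra.
Qed.

Lemma upper_unit_gt0 (x : R) : 0 < x < 1 -> 0 < upper_unit x ord0 ord_max.
Proof. by move=> /andP[x0 x1]; rewrite mxE /= sqrtr_gt0; nra. Qed.

Lemma unit_combD m a c c' : unit_comb m a (fun i => c i + c' i) =
  unit_comb m a c + unit_comb m a c'.
Proof.
rewrite /unit_comb -big_split; apply: eq_bigr => i _.
by rewrite rmorphD scalerDl.
Qed.

Lemma unit_combN m a c : unit_comb m a (fun i => - c i) = - unit_comb m a c.
Proof.
rewrite /unit_comb -sumrN; apply: eq_bigr => i _.
by rewrite rmorphN scaleNr.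
Qed.

Lemma unit_combZ m a c (t : rat) :
  unit_comb m a (fun i => t * c i) = ratr t *: unit_comb m a c.
Proof.
rewrite /unit_comb scaler_sumr; apply: eq_bigr => i _.
by rewrite rmorphM scalerA.
Qed.

Lemma unit_comb_single m a c k : (k < m)%N ->
  (forall i, (i < m)%N -> i != k -> c i = 0) ->
  unit_comb m a c = ratr (c k) *: upper_unit (a k).
Proof.
move=> ltkm c0; rewrite /unit_comb (bigD1 (Ordinal ltkm)) //= big1 ?addr0 //.
by move=> i neik; rewrite c0 ?rmorph0 ?scale0r.
Qed.

(** If [c k != 0] in a vanishing combination [c], then the [k]-th vector plus
    [c / c k] is still a unit combination, with coefficient 2 at [k]; by
    genericity all other coefficients vanish. *)
Lemma generic_independent m a c : generic m a -> unit_comb m a c = 0 ->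
  forall i, (i < m)%N -> c i = 0.
Proof.
move=> [a01 gen] comb0 k ltkm; apply/eqP/negPn/negP => ck.
pose e i : rat := (i == k)%:R + (c k)^-1 * c i.
have ek : e k != 0 by rewrite /e eqxx mulVf.
have other j : (j < m)%N -> j != k -> c j = 0.
  move=> ltjm /[dup] nejk /eqP; apply: contra_notP => /eqP cj.
  apply: (gen e) => //.
    rewrite unit_combD unit_combZ comb0 scaler0 addr0.
    rewrite (unit_comb_single _ ltkm) => [|i _ /negPf-> //].
    by rewrite eqxx rmorph1 scale1r enorm_upper_unit ?a01.
  by rewrite /e (negPf nejk) add0r mulf_neq0 ?invr_eq0.
move: comb0; rewrite (unit_comb_single _ ltkm other) => /rowP/(_ ord0).
rewrite !mxE /= => /eqP; rewrite mulf_eq0 fmorph_eq0 (negPf ck) /=.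
by have /andP[/lt0r_neq0/negPf->] := a01 k ltkm.
Qed.

Lemma exists_notin_range (T : countType) (f : T -> R) :
  exists x, 0 < x < 1 /\ forall t, f t != x.
Proof.
apply: contrapT => none.
have sub : `]0%R, 1%R[%classic `<=` range f.
  move=> x /=; rewrite in_itv /= => x01; apply: contrapT => notin.
  apply: none; exists x; split=> // t; apply/eqP => ftx.
  by apply: notin; exists t.
have cnt : countable (`]0%R, 1%R[%classic : set R).
  apply: sub_countable (subset_card_le sub) _.
  exact: sub_countable (card_image_le _ _) (countableP _).
have := countable_lebesgue_measure0 cnt.
by rewrite lebesgue_measure_itv /= lte01 sube0 => /eqP; rewrite onee_eq0.
Qed.

(** The two possible abscissas of a point [z] of the unit circle on the line
    [p * z_0 + q * z_1 = r]. *)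
Definition line_circle (p q r : R) (b : bool) : R :=
  (p * r + (-1) ^+ b * Num.sqrt (q ^+ 2 * (p ^+ 2 + q ^+ 2 - r ^+ 2)))
  / (p ^+ 2 + q ^+ 2).

Lemma line_circleP (p q r x : R) : p ^+ 2 + q ^+ 2 != 0 -> 0 < x < 1 ->
  p * x + q * Num.sqrt (1 - x ^+ 2) = r ->
  exists b, line_circle p q r b = x.
Proof.
move=> A0 x01; set s := Num.sqrt _ => eq_r.
have s2 : s ^+ 2 = 1 - x ^+ 2 by rewrite sqr_sqrtr //; nra.
have disc : q ^+ 2 * (p ^+ 2 + q ^+ 2 - r ^+ 2)
          = ((p ^+ 2 + q ^+ 2) * x - p * r) ^+ 2.
  rewrite -eq_r.
  have -> : q ^+ 2 * (p ^+ 2 + q ^+ 2 - (p * x + q * s) ^+ 2) =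
    q ^+ 2 * (p ^+ 2 + q ^+ 2 - p ^+ 2 * x ^+ 2 - 2 * p * q * x * s
              - q ^+ 2 * s ^+ 2) by ring.
  have -> : ((p ^+ 2 + q ^+ 2) * x - p * (p * x + q * s)) ^+ 2 =
    q ^+ 2 * (q ^+ 2 * x ^+ 2 - 2 * p * q * x * s + p ^+ 2 * s ^+ 2) by ring.
  by rewrite s2; ring.
rewrite /line_circle disc sqrtr_sqr.
exists ((p ^+ 2 + q ^+ 2) * x - p * r < 0).
set z := (_ * x - _); have -> : (-1) ^+ (z < 0)%R * `|z| = z.
  have [z0|z0] := ltrP z 0; first by rewrite expr1 mulN1r ltr0_norm // opprK.
  by rewrite expr0 mul1r ger0_norm.
by rewrite /z; field.
Qed.

(** A new vector has to avoid, for each of the countably many nonzero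
    combinations [u] of the previous ones and each rational coefficient, the
    intersections of the circle with a line orthogonal to [u]. *)
Lemma generic_exists m : exists a, generic m a.
Proof.
elim: m => [|m [a gen]]; first by exists (fun=> 0).
have [a01 gen_unit] := gen.
pose comb (c : {ffun 'I_m -> rat}) : 'rV[R]_2 :=
  \sum_(i < m) ratr (c i) *: upper_unit (a i).
pose f (s : {ffun 'I_m -> rat} * rat * bool) : R :=
  let: (c, q, b) := s in
  let p0 := comb c ord0 ord0 in let p1 := comb c ord0 ord_max in
  line_circle p0 p1
    ((1 - ratr q ^+ 2 - (p0 ^+ 2 + p1 ^+ 2)) / (2 * ratr q)) b.
have [x [x01 fx]] := exists_notin_range f.
pose a' i := if (i < m)%N then a i else x.
have a'm : a' m = x by rewrite /a' ltnn.
have combE c :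
    unit_comb m.+1 a' c = unit_comb m a c + ratr (c m) *: upper_unit x.
  rewrite /unit_comb big_ord_recr /= a'm; congr (_ + _).
  by apply: eq_bigr => i _; rewrite /a' ltn_ord.
exists a'; split=> [i _|c].
  by rewrite /a'; case: ifP => // ltim; apply: a01.
rewrite combE => unit_c.
have [cm0|cm0] := eqVneq (c m) 0.
  move: unit_c; rewrite cm0 rmorph0 scale0r addr0 => unit_c.
  have lt_m i : (i < m.+1)%N -> c i != 0 -> (i < m)%N.
    rewrite ltnS leq_eqVlt => /orP[/eqP-> /eqP//|//].
  move=> i j lti ltj ci cj.
  by apply: (gen_unit c) => //; apply: lt_m.
pose u := unit_comb m a c; rewrite -/u in unit_c.
have [u0|u_neq0] := eqVneq u 0.
  have only_m i : (i < m.+1)%N -> c i != 0 -> i = m.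
    rewrite ltnS leq_eqVlt => /orP[/eqP//|ltim].
    by rewrite (generic_independent gen u0 ltim) eqxx.
  by move=> i j lti ltj ci cj; rewrite (only_m i) // (only_m j).
have comb_u : comb [ffun i : 'I_m => c i] = u.
  by apply: eq_bigr => i _; rewrite ffunE.
pose q : R := ratr (c m).
have q0 : q != 0 by rewrite fmorph_eq0.
have A0 : u ord0 ord0 ^+ 2 + u ord0 ord_max ^+ 2 != 0.
  apply: contra_neq u_neq0 => /eqP; rewrite paddr_eq0 ?sqr_ge0 // !sqrf_eq0.
  move=> /andP[/eqP u0 /eqP u1]; apply/rowP => j; rewrite mxE.
  by case: j => [[|[|//]] ltj]; [rewrite -u0 | rewrite -u1];
     congr (u _ _); apply: val_inj.
have x_line : u ord0 ord0 * x + u ord0 ord_max * Num.sqrt (1 - x ^+ 2) =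
    (1 - q ^+ 2 - (u ord0 ord0 ^+ 2 + u ord0 ord_max ^+ 2)) / (2 * q).
  have s2 : Num.sqrt (1 - x ^+ 2) ^+ 2 = 1 - x ^+ 2 by rewrite sqr_sqrtr //; nra.
  have /enorm_eq1 := unit_c; rewrite !mxE /= -/q.
  move: s2; set s := Num.sqrt _; set p0 := u _ _; set p1 := u _ _ => s2 eq1.
  have : 2 * q * (p0 * x + p1 * s) = 1 - q ^+ 2 - (p0 ^+ 2 + p1 ^+ 2).
    have -> : 1 = (p0 + q * x) ^+ 2 + (p1 + q * s) ^+ 2 by [].
    have : q ^+ 2 * s ^+ 2 = q ^+ 2 * (1 - x ^+ 2) by rewrite s2.
    by move=> q2; nra.
  by move=> <-; field.
have [b fb] := line_circleP A0 x01 x_line.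
by have := fx ([ffun i : 'I_m => c i], c m, b); rewrite /f comb_u fb eqxx.
Qed.

End GenericDirections.

(** * Unit distances: an extremal set *)

Section PlaneLower.
Variable R : realType.

(** The planar image of a vertex of the hypercube, the digits of [p] being the
    coefficients of the vectors [upper_unit (a i)]. *)
Definition binary_point (n : nat) (a : nat -> R) (p : nat) : 'rV[R]_2 :=
  unit_comb n a (fun i => (odd (p %/ 2 ^ i))%:R).

Lemma binary_pointB (n : nat) (a : nat -> R) (p q : nat) :
  binary_point n a p - binary_point n a q =
  unit_comb n a (fun i => (odd (p %/ 2 ^ i))%:R - (odd (q %/ 2 ^ i))%:R).
Proof. by rewrite -unit_combN -unit_combD. Qed.

Lemma generic_upper_unit_inj (n : nat) (a : nat -> R) (i j : nat) :
  generic n a -> (i < n)%N -> (j < n)%N ->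
  upper_unit (a i) = upper_unit (a j) -> i = j.
Proof.
move=> gen lti ltj eq_ij; apply/eqP/negPn/negP => ne_ij.
have := @generic_independent _ n a (fun k => (k == i)%:R - (k == j)%:R) gen.
move=> /(_ _ i lti); rewrite /= eqxx (negPf ne_ij) subr0.
suff zero : unit_comb n a (fun k => (k == i)%:R - (k == j)%:R) = 0.
  by move=> /(_ zero)/eqP; rewrite oner_eq0.
rewrite unit_combD unit_combN.
rewrite (unit_comb_single _ lti) => [|k _ /negPf->//].
rewrite (unit_comb_single _ ltj) => [|k _ /negPf->//].
by rewrite !eqxx rmorph1 !scale1r eq_ij subrr.
Qed.

Lemma upper_units_independent (n : nat) (a : nat -> R) (D : set 'rV[R]_2) :
  generic n a ->
  (forall v, D v -> exists2 i, (i < n)%N & v = upper_unit (a i)) ->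
  rationally_independent D.
Proof.
move=> gen sub F c FD comb0 v vF.
have [i lti vE] := sub v (FD v vF).
pose e (k : nat) := if upper_unit (a k) \in F then c (upper_unit (a k)) else 0.
suff comb_e : unit_comb n a e = 0.
  by have := generic_independent gen comb_e lti; rewrite /e -vE vF.
rewrite -comb0 [RHS]big_seq_cond /unit_comb.
transitivity (\sum_(k < n) \sum_(w <- F | w == upper_unit (a k)) ratr (c w) *: w).
  apply: eq_bigr => k _; rewrite /e; case: ifP => [kF|kF].
    rewrite [RHS]big_mkcond (bigD1_seq (upper_unit (a k))) ?fset_uniq //= eqxx.
    by rewrite big1 ?addr0 // => w /negPf->.
  rewrite rmorph0 scale0r big_seq_cond big1 // => w /andP[wF /eqP wE].
  by rewrite -wE wF in kF.
rewrite (exchange_big_dep xpredT) //= [LHS]big_seq_cond.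
apply: eq_bigr => w /andP[wF _].
have [j ltj wE] := sub w (FD w wF).
rewrite (big_pred1 (Ordinal ltj)) // => k /=.
apply/eqP/eqP => [wk|->//]; apply: val_inj => /=.
by apply: (generic_upper_unit_inj gen) => //; rewrite -wk.
Qed.

(** By genericity the only unit vectors among the differences of these points
    are the generic unit vectors and their opposites; the latter have their
    argument outside [0, pi). *)
Lemma binary_point_directions (n : nat) (a : nat -> R) (A : {fset 'rV[R]_2}) :
  generic n a -> (forall x, x \in A -> exists p, x = binary_point n a p) ->
  forall v, unit_directions A v -> exists2 i, (i < n)%N & v = upper_unit (a i).
Proof.
move=> gen A_binary v [x [y [/A_binary[p ->] /A_binary[q ->] -> norm1 up]]].
have [a01 gen_unit] := gen.
rewrite binary_pointB in norm1 up *.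
set c := (fun i => _ - _) in norm1 up *.
have [i lti ci] : exists2 i, (i < n)%N & c i != 0.
  apply: contrapT => none.
  have comb0 : unit_comb n a c = 0.
    rewrite /unit_comb big1 // => k _.
    have [->|ck] := eqVneq (c k) 0; first by rewrite rmorph0 scale0r.
    by case: none; exists k.
  move: norm1; rewrite comb0 => /enorm_eq1; rewrite !mxE expr0n addr0 => /eqP.
  by rewrite eq_sym oner_eq0.
exists i => //; move: up.
rewrite (unit_comb_single a lti) => [|k ltk]; last first.
  by move=> /eqP; apply: contra_notP => /eqP ck; apply: (gen_unit c).
have [->|->] : c i = 1 \/ c i = -1.
- move: ci; rewrite /c; case: odd; case: odd => /=; rewrite ?subrr ?eqxx //.
    by left; rewrite subr0.
  by right; rewrite sub0r.
- by rewrite rmorph1 scale1r.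
rewrite rmorphN rmorph1 scaleN1r => -[theta [_ _ sinE] /andP[theta0 theta_pi]].
have := upper_unit_gt0 (a01 i lti).
have : 0 <= sin theta by apply: sin_ge0_pi; rewrite theta0 ltW.
move: sinE; rewrite enormN enorm_upper_unit ?a01 // mul1r mxE => <-.
by rewrite oppr_ge0 leNgt => /negPf->.
Qed.

Lemma planar_count_max (n : nat) : is_max (planar_counts R n) (digit_total n).
Proof.
split=> [|_ [A [<- indep <-]]]; last exact: planar_num_edges_le.
have [a gen] := generic_exists R n; have [a01 _] := gen.
pose w := binary_point n a.
have digit_lt p i : (p < n)%N -> (n <= i)%N -> odd (p %/ 2 ^ i) = false.
  move=> ltp lei; rewrite divn_small // (ltn_trans ltp) //.
  by rewrite (leq_trans (ltn_expl n (ltnSn 1))) // leq_exp2l.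
have w_inj p q : (p < n)%N -> (q < n)%N -> w p = w q -> p = q.
  move=> ltp ltq /eqP; rewrite -subr_eq0 binary_pointB => /eqP comb0.
  apply: eq_binary_digits => i; case: (ltnP i n) => lei; last by rewrite !digit_lt.
  have := generic_independent gen comb0 lei => /eqP; rewrite subr_eq0.
  by case: odd; case: odd => //=; rewrite ?oner_eq0 // eq_sym oner_eq0.
have w_adj p i : (p < n)%N -> odd (p %/ 2 ^ i) -> unit_dist (w p) (w (p - 2 ^ i)%N).
  move=> ltp odd_i; have lti : (i < n)%N.
    by case: ltnP => // /(digit_lt p i ltp); rewrite odd_i.
  rewrite /unit_dist binary_pointB (unit_comb_single a lti) => [|j _ neji].
    rewrite (binary_digit_sub _ odd_i) eqxx odd_i subr0 rmorph1 scale1r.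
    by rewrite enorm_upper_unit ?a01.
  by rewrite (binary_digit_sub _ odd_i) neji subrr.
pose A := [fset w i | i in iota 0 n]%fset.
have cardA : #|` A| = n.
  rewrite card_in_imfset /=; first by rewrite undup_id ?iota_uniq // size_iota.
  by move=> p q; rewrite !mem_iota !add0n => /= ltp ltq; apply: w_inj.
have indep : rationally_independent (unit_directions A).
  apply: (upper_units_independent gen); apply: (binary_point_directions gen).
  by move=> x /imfsetP[p _ ->]; exists p.
exists A; split=> //.
have := planar_num_edges_le indep; rewrite cardA => le_edges.
apply/eqP; rewrite eqn_leq le_edges /=.
exact: digit_total_le_num_edges.
Qed.

End PlaneLower.

(** * Asymptotics *)

Section Growth.
Variable R : realType.

Lemma log2_exp2 (L : nat) : log2 ((2 ^ L)%:R : R) = L%:R.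
Proof.
have ln2 : ln (2 : R) != 0 by rewrite gt_eqF // ln_gt0 // ltr1n.
by rewrite /log2 natrX lnXn // -[_ *+ _]mulr_natr mulrAC mulfV // mul1r.
Qed.

Lemma ler_log2 (m n : nat) : (0 < m)%N -> (m <= n)%N ->
  log2 (m%:R : R) <= log2 n%:R.
Proof.
move=> m0 lemn; rewrite /log2 ler_pM2r ?invr_gt0 ?ln_gt0 ?ltr1n //.
by rewrite ler_ln ?posrE ?ltr0n ?ler_nat // (leq_trans m0).
Qed.

Lemma ltr_log2 (m n : nat) : (0 < m)%N -> (m < n)%N ->
  log2 (m%:R : R) < log2 n%:R.
Proof.
move=> m0 ltmn; rewrite /log2 ltr_pM2r ?invr_gt0 ?ln_gt0 ?ltr1n //.
by rewrite ltr_ln ?posrE ?ltr0n ?ltr_nat // (ltn_trans m0).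
Qed.

Lemma exp2_bracket (n : nat) : (2 <= n)%N ->
  exists L, (2 ^ L < n)%N && (n <= 2 ^ L.+1)%N.
Proof.
move=> n2; have ex : exists L, (n <= 2 ^ L)%N.
  by exists n; apply/ltnW/ltn_expl.
case: (ex_minnP ex) => -[|L] leL min_L; first by lia.
exists L; rewrite leL andbT ltnNge; apply/negP => /min_L; lia.
Qed.

Lemma ceil_log2 (n L : nat) : (2 ^ L < n)%N -> (n <= 2 ^ L.+1)%N ->
  Num.ceil (log2 (n%:R : R)) = L.+1%:Z.
Proof.
move=> ltLn lenL; apply: ceil_def; apply/andP; split.
  have -> : (L.+1%:Z - 1)%:~R = L%:R :> R.
    by rewrite intrB -pmulrn -natr1 addrK.
  by rewrite -(log2_exp2 L) ltr_log2 // expn_gt0.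
rewrite -pmulrn -(log2_exp2 L.+1) ler_log2 //.
by rewrite (leq_ltn_trans _ ltLn).
Qed.

Lemma digit_total_lower (n : nat) : (1 <= n)%N ->
  n%:R / 4 * ((Num.ceil (log2 (n%:R : R)))%:~R - 1) < (digit_total n)%:R :> R.
Proof.
case: n => [//|[|n]] _.
  have -> : log2 (1%:R : R) = 0 by rewrite (log2_exp2 0).
  by rewrite ceil0 digit_total1 mulr0z; lra.
have [L /andP[ltL leL]] := exp2_bracket (isT : (2 <= n.+2)%N).
rewrite (ceil_log2 ltL leL) -pmulrn.
have := digit_total_gt ltL leL; rewrite -(ltr_nat R) !natrM -natr1.
by lra.
Qed.

Lemma digit_total_upper (n : nat) : (2 <= n)%N ->
  (digit_total n)%:R < n%:R * (Num.ceil (log2 (n%:R : R)))%:~R :> R.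
Proof.
move=> n2; have [L /andP[ltL leL]] := exp2_bracket n2.
rewrite (ceil_log2 ltL leL) -pmulrn -natrM ltr_nat.
by have := digit_total_le leL; nia.
Qed.

Lemma digit_total_Theta :
  (fun n : nat => (digit_total n)%:R : R^o) =Theta_\oo
  (fun n : nat => n%:R * log2 (n%:R : R) : R^o).
Proof.
rewrite eqThetaE qualifE; apply/asboolP; exists (8^-1, 1).
  by rewrite /= ltr01 andbT invr_gt0.
exists 3%N => // n /= n3; rewrite mul1r.
have [L /andP[ltL leL]] := exp2_bracket (ltnW n3 : (2 <= n)%N).
have log_le : log2 (n%:R : R) <= L.+1%:R.
  by rewrite -(log2_exp2 L.+1) ler_log2 // (ltn_trans _ n3).
have log_ge : L%:R <= log2 (n%:R : R).
  by rewrite -(log2_exp2 L) ler_log2 ?expn_gt0 // ltnW.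
have L1 : 1 <= L%:R :> R.
  by rewrite ler1n; case: (L) leL => // leL; rewrite expn1 in leL; lia.
have le_T := digit_total_le leL; have gt_T := digit_total_gt ltL leL.
rewrite -(ler_nat R) !natrM in le_T; rewrite -(ltr_nat R) !natrM in gt_T.
have n0 : 0 <= n%:R :> R := ler0n _ _.
have T0 : 0 <= (digit_total n)%:R :> R := ler0n _ _.
rewrite -natr1 in log_le le_T.
have log0 : 0 <= n%:R * log2 (n%:R : R) by rewrite mulr_ge0 //; lra.
by rewrite (ger0_norm T0) (ger0_norm log0); split; nra.
Qed.

End Growth.

Theorem theorem1p1 (R : realType) :
  exists T : nat -> nat,
    (forall n : nat, (1 <= n)%N ->
      [/\ is_max (planar_counts R n) (T n),
          is_max (lattice_counts n) (T n) &
          is_max (cube_counts n) (T n)]) /\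
    (forall n : nat, (1 <= n)%N ->
      (T n.+1)%:Z - (T n)%:Z = (hamming_weight n)%:Z) /\
    (forall (n t : nat) (k : 'I_t -> nat), (1 <= n)%N ->
      (forall i j : 'I_t, (i < j)%N -> (k j < k i)%N) ->
      n = (\sum_(j < t) 2 ^ k j)%N ->
      T n = (\sum_(j < t) (k j * 2 ^ (k j).-1 + j * 2 ^ k j))%N) /\
    (forall n : nat, (1 <= n)%N ->
      n%:R / 4 * ((Num.ceil (log2 (n%:R : R)))%:~R - 1) < (T n)%:R :> R) /\
    (forall n : nat, (2 <= n)%N ->
      (T n)%:R < n%:R * (Num.ceil (log2 (n%:R : R)))%:~R :> R) /\
    ((fun n : nat => (T n)%:R : R^o) =Theta_\oo
       (fun n : nat => n%:R * log2 (n%:R : R) : R^o)).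
Proof.
exists digit_total; split; [|split; [|split; [|split; [|split]]]].
- move=> n _; split; first exact: planar_count_max.
    exact: lattice_count_max.
  exact: cube_count_max.
- by move=> n _; rewrite digit_totalS PoszD addrAC subrr add0r.
- by move=> n t k _ decr ->; apply: digit_total_binary.
- exact: digit_total_lower.
- exact: digit_total_upper.
- exact: digit_total_Theta.
Qed.
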